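(* Let $q$ be a prime power, $A=\mathbb{F}_q[T]$, and let $\mathfrak p\neq\mathfrak q$ be finite primes of $A$; write $\mathbb{F}_{\mathfrak p}=A/\mathfrak p$. Let $\Gamma_{\mathfrak p}(\mathfrak q)$ be the graph of supersingular rank-two Drinfeld $A$-modules in characteristic $\mathfrak p$ with edges given by cyclic $\mathfrak q$-isogenies, let $S_{\mathfrak p}$ be the supersingular polynomial in characteristic $\mathfrak p$, and let $\overline{\Phi}_{\mathfrak q}\in\mathbb{F}_{\mathfrak p}[X,Y]$ be the reduction modulo $\mathfrak p$ of the modular $\mathfrak q$-polynomial. The graph $\Gamma_{\mathfrak p}(\mathfrak q)$ is complete (including self-loops) if and only if $$\overline{\Phi}_{\mathfrak q}(X,Y)\in\bigl(S_{\mathfrak p}(X),S_{\mathfrak p}(Y)\bigr)\subseteq\mathbb{F}_{\mathfrak p}[X,Y].$$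
   Context: Primes are identified with their monic generators. An $A$-field is a field $L$ with an $\mathbb{F}_q$-algebra homomorphism $\gamma:A\to L$; its $A$-characteristic is $\ker\gamma$. For an algebraically closed $A$-field $L$, $L\{\tau\}$ is the twisted polynomial ring with $\tau c=c^q\tau$; $u=\sum_iu_i\tau^i$ acts on $L$ by $u(x)=\sum_iu_ix^{q^i}$. A rank-two Drinfeld $A$-module over $L$ is an $\mathbb{F}_q$-algebra homomorphism $\phi:A\to L\{\tau\}$, $a\mapsto\phi_a$, determined by $\phi_T=\gamma(T)+g\tau+\Delta\tau^2$, $g,\Delta\in L$, $\Delta\ne0$; its $j$-invariant is $j(\phi)=g^{q+1}/\Delta$, a complete invariant of isomorphism classes over $L$. $\phi[a]=\{x\in L:\phi_a(x)=0\}$, an $A$-module via $a\cdot x=\phi_a(x)$. A morphism $u:\phi\to\psi$ is $u\in L\{\tau\}$ with $u\phi_T=\psi_Tu$; it is an isogeny if nonzero and an isomorphism if $u\in L^\times$. A cyclic $\mathfrak q$-isogeny ($\mathfrak q$ different from the characteristic) is a separable isogeny ($u_0\ne0$) with kernel $\ker(u)=\{\alpha\in L:u(\alpha)=0\}\cong A/\mathfrak q$ as an $A$-module. For a finite $A$-submodule $C\subseteq\phi[\mathfrak q]$, $\phi/C$ denotes the Drinfeld module (unique up to isomorphism) that is the target of a separable isogeny from $\phi$ with kernel $C$. Take $L=\overline{\mathbb{F}}_{\mathfrak p}$ with $\gamma$ the reduction map. $\phi$ is supersingular if $\phi[\mathfrak p]=\{0\}$. Let $\phi_1,\dots,\phi_n$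 represent the isomorphism classes of supersingular rank-two Drinfeld modules over $\overline{\mathbb{F}}_{\mathfrak p}$, with $j_i=j(\phi_i)$. These classes are the vertices of $\Gamma_{\mathfrak p}(\mathfrak q)$. The graph is complete (including self-loops) if for every $i,j$ (including $i=j$) there is a cyclic $\mathfrak q$-isogeny $\phi_i\to\phi_j$. The supersingular polynomial is $S_{\mathfrak p}(X)=\prod_{i=1}^n(X-j_i)$, which has coefficients in $\mathbb{F}_{\mathfrak p}$. The modular $\mathfrak q$-polynomial $\Phi_{\mathfrak q}(X,Y)\in A[X,Y]$, monic in $Y$, is the polynomial such that $$\Phi_{\mathfrak q}(j(\phi),Y)=\prod_{C\subseteq\phi[\mathfrak q],\ C\cong A/\mathfrak q}\bigl(Y-j(\phi/C)\bigr)$$ for all rank-two Drinfeld modules $\phi$ of $A$-characteristic different from $\mathfrak q$; $\overline{\Phi}_{\mathfrak q}$ is its coefficientwise reduction modulo $\mathfrak p$. *)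

(* Defs.v *)
From HB Require Import structures.
From mathcomp Require Import all_boot all_order all_algebra all_field.
From mathcomp Require Import boolp classical_sets fsbigop.

Set Implicit Arguments.
Unset Strict Implicit.
Unset Printing Implicit Defensive.

Import GRing.Theory.
Local Open Scope classical_set_scope.
Local Open Scope ring_scope.

(* F is the field with #|F| elements written F_q in the mathematics, and      *)
(* A = F_q[T] is {poly F} with T = 'X. An A-field is a field L together with  *)
(* gamma : {rmorphism {poly F} -> L}; its F_q-algebra structure is the one    *)
(* induced by gamma. The letters p and q denote primes of A.                  *)

Section TwistedPolynomials.
Variables (F : finFieldType) (L : fieldType) (gamma : {rmorphism {poly F} -> L}).

(* L{tau}: \sum_i u_i tau^i is stored as the coefficient sequence \sum_i u_i  *)
(* 'X^i. The index gamma only serves to make the #|F|-power map additive on   *)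
(* L; {poly L} provides the coefficients, not the product.                    *)
Record twisted (g : {rmorphism {poly F} -> L}) : Type :=
  Twisted { twisted_coef :> {poly L} }.

Local Notation Ltau := (twisted gamma).

HB.instance Definition _ := [isNew for @twisted_coef gamma].
HB.instance Definition _ := [Choice of Ltau by <:].

Implicit Types (u v w : Ltau).

Lemma twistedP u v : (forall i, u`_i = v`_i) <-> u = v.
Proof. by split=> [uv|-> //]; apply: val_inj; apply/polyP. Qed.

Definition twisted_add u v : Ltau := Twisted gamma (twisted_coef u + v).
Definition twisted_opp u : Ltau := Twisted gamma (- twisted_coef u).

Fact twisted_addA : associative twisted_add.
Proof. by move=> u v w; apply: val_inj; rewrite /= addrA. Qed.
Fact twisted_addC : commutative twisted_add.
Proof. by move=> u v; apply: val_inj; rewrite /= addrC. Qed.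
Fact twisted_add0 : left_id (Twisted gamma 0) twisted_add.
Proof. by move=> u; apply: val_inj; rewrite /= add0r. Qed.
Fact twisted_addN : left_inverse (Twisted gamma 0) twisted_opp twisted_add.
Proof. by move=> u; apply: val_inj; rewrite /= addNr. Qed.

HB.instance Definition _ := GRing.isZmodule.Build Ltau
  twisted_addA twisted_addC twisted_add0 twisted_addN.

Lemma expqD (x y : L) (i : nat) :
  (x + y) ^+ (#|F| ^ i) = x ^+ (#|F| ^ i) + y ^+ (#|F| ^ i).
Proof.
have [r r_pr charF] := finPcharP F.
have charL : r \in [pchar L].
  rewrite inE r_pr /=; apply/eqP.
  by rewrite -(rmorph_nat gamma) -polyC_natr (pcharf0 charF) polyC0 rmorph0.
apply: exprDn_pchar.
rewrite (eq_pnat _ (pcharf_eq charL)) pnatX; apply/orP; left.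
by rewrite (card_pprimeChar charF) pnatX pnat_id.
Qed.

Lemma expq0 (i : nat) : 0 ^+ (#|F| ^ i) = 0 :> L.
Proof.
by rewrite expr0n eqn0Ngt expn_gt0 (ltn_trans _ (finNzRing_gt1 F)).
Qed.

Lemma expq_sum (I : Type) (s : seq I) (f : I -> L) (i : nat) :
  (\sum_(x <- s) f x) ^+ (#|F| ^ i) = \sum_(x <- s) f x ^+ (#|F| ^ i).
Proof.
elim: s => [|x s IH]; first by rewrite !big_nil expq0.
by rewrite !big_cons expqD IH.
Qed.

(* tau^i * c = c ^+ (q ^ i) * tau^i *)
Definition twisted_mul u v : Ltau := Twisted gamma
  (\poly_(k < size u + size v)
     \sum_(i < k.+1) u`_i * v`_(k - i) ^+ (#|F| ^ i)).

Definition twisted_const (c : L) : Ltau := Twisted gamma c%:P.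
Definition twisted_tau : Ltau := Twisted gamma 'X.

Lemma coef_twisted_mul u v k :
  (twisted_mul u v)`_k = \sum_(i < k.+1) u`_i * v`_(k - i) ^+ (#|F| ^ i).
Proof.
rewrite coef_poly; case: ltnP => // uvk; rewrite big1 // => -[i /= ik] _.
have [ui|iu] := leqP (size u) i; first by rewrite nth_default ?mul0r.
rewrite [X in X ^+ _](nth_default 0) ?expq0 ?mulr0 //.
by rewrite leq_subRL //; apply: leq_trans uvk; rewrite leq_add2r ltnW.
Qed.

Fact twisted_mulA : associative twisted_mul.
Proof.
move=> u v w; apply/twistedP => k; rewrite !coef_twisted_mul.
pose f i j := u`_i * v`_j ^+ (#|F| ^ i) * w`_(k - (i + j)) ^+ (#|F| ^ (i + j)).
transitivity (\sum_(i < k.+1) \sum_(m < k.+1 | (i <= m)%N) f i (m - i)%N).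
  apply: eq_bigr => -[i /= ik] _; rewrite coef_twisted_mul expq_sum big_distrr /=.
  rewrite -(big_mkord xpredT (fun j => u`_i * (v`_j * w`_(k - i - j) ^+ (#|F| ^ j)) ^+ (#|F| ^ i))).
  rewrite -(big_mkord (fun m => i <= m)%N (fun m => f i (m - i)%N)).
  rewrite [RHS](big_cat_nat (n := i)) //=; last exact: ltnW.
  have -> : \sum_(0 <= m < i | (i <= m)%N) f i (m - i)%N = 0.
    by rewrite big_nat_cond big1 // => m /andP[/= mi]; rewrite leqNgt mi.
  rewrite add0r; symmetry.
  rewrite -[X in \sum_(X <= _ < _ | _) _]add0n big_addn subSn //.
  rewrite big_mkcond; apply: eq_bigr => j _; rewrite leq_addl addnK /f.
  by rewrite exprMn mulrA -exprM -expnD subnDA (addnC j i).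
rewrite (exchange_big_dep xpredT) //=; apply: eq_bigr => -[m /= mk] _.
rewrite coef_twisted_mul big_distrl /=.
rewrite -(big_mkord (fun i => i <= m)%N (fun i => f i (m - i)%N)).
rewrite -(big_mkord xpredT (fun i => u`_i * v`_(m - i) ^+ (#|F| ^ i) * w`_(k - m) ^+ (#|F| ^ m))).
rewrite [RHS](big_nat_widen _ _ k.+1) // big_nat_cond [RHS]big_nat_cond.
apply: eq_big => [i|i]; first by [].
by case/andP=> _ im; rewrite /f subnKC.
Qed.

Fact twisted_mul1 : left_id (twisted_const 1) twisted_mul.
Proof.
move=> u; apply/twistedP => k; rewrite coef_twisted_mul big_ord_recl /=.
rewrite coefC eqxx mul1r expn0 expr1 subn0 big1 ?addr0 // => i _.
by rewrite coefC mul0r.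
Qed.

Fact twisted_mulr1 : right_id (twisted_const 1) twisted_mul.
Proof.
move=> u; apply/twistedP => k; rewrite coef_twisted_mul big_ord_recr /=.
rewrite subnn coefC eqxx expr1n mulr1 big1 ?add0r // => -[i /= ik] _.
by rewrite coefC subn_eq0 leqNgt ik /= expq0 mulr0.
Qed.

Fact twisted_mulDl : left_distributive twisted_mul +%R.
Proof.
move=> u v w; apply/twistedP => k; rewrite coefD !coef_twisted_mul -big_split.
by apply: eq_bigr => i _; rewrite coefD mulrDl.
Qed.

Fact twisted_mulDr : right_distributive twisted_mul +%R.
Proof.
move=> u v w; apply/twistedP => k; rewrite coefD !coef_twisted_mul -big_split.
by apply: eq_bigr => i _; rewrite coefD expqD mulrDr.
Qed.

Fact twisted_1neq0 : twisted_const 1 != 0.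
Proof. by apply/eqP => /(congr1 val) /eqP; rewrite /= polyC_eq0 oner_eq0. Qed.

HB.instance Definition _ := GRing.Zmodule_isNzRing.Build Ltau
  twisted_mulA twisted_mul1 twisted_mulr1 twisted_mulDl twisted_mulDr
  twisted_1neq0.

Definition twisted_eval u (x : L) : L :=
  \sum_(i < size u) u`_i * x ^+ (#|F| ^ i).

Definition twisted_ker u : set L := [set x | twisted_eval u x = 0].

End TwistedPolynomials.

Arguments twisted_tau {F L} gamma.
Arguments twisted_const {F L} gamma c.

Section Drinfeld.
Variables (F : finFieldType) (L : closedFieldType).
Variable (gamma : {rmorphism {poly F} -> L}).

Local Notation Ltau := (twisted gamma).
Local Notation tau := (twisted_tau gamma).
Local Notation "c %:tau" := (twisted_const gamma c) (at level 2, format "c %:tau").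

Record drinfeld : Type := Drinfeld {
  dmap :> {rmorphism {poly F} -> Ltau};
  dg : L;
  dDelta : L;
  dmapC : forall c : F, dmap c%:P = (gamma c%:P)%:tau;
  dmapT : dmap 'X = (gamma 'X)%:tau + dg%:tau * tau + dDelta%:tau * tau ^+ 2;
  dDelta_neq0 : dDelta != 0
}.

HB.instance Definition _ := gen_eqMixin drinfeld.
HB.instance Definition _ := gen_choiceMixin drinfeld.

Implicit Types (phi psi : drinfeld) (a p q : {poly F}) (C : set L) (u : Ltau).

Definition jinv phi : L := dg phi ^+ #|F|.+1 / dDelta phi.

Definition torsion phi a : set L := twisted_ker (phi a).

Definition supersingular p phi : Prop := torsion phi p = [set 0].

Definition drinfeld_morphism phi psi u : Prop := u * phi 'X = psi 'X * u.

Definition drinfeld_isomorphic phi psi : Prop :=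
  exists2 c : L, c != 0 & drinfeld_morphism phi psi c%:tau.

Definition separable_isogeny phi psi u : Prop :=
  [/\ u != 0, drinfeld_morphism phi psi u & u`_0 != 0].

Definition submodule phi C : Prop :=
  [/\ C 0, forall x y, C x -> C y -> C (x + y)
    & forall a x, C x -> C (twisted_eval (phi a) x)].

(* An isomorphism of A-modules A/q -> C, where a acts on C by phi_a. *)
Definition iso_quotA phi q C : Prop :=
  exists f : {poly %/ q} -> L,
    [/\ injective f, range f = C, {morph f : x y / x + y}
      & forall a x, f (in_qpoly q a * x) = twisted_eval (phi a) (f x)].

Definition cyclic_isogeny q phi psi u : Prop :=
  separable_isogeny phi psi u /\ iso_quotA phi q (twisted_ker u).

Definition cyclic_submodules phi q : set (set L) :=
  [set C | [/\ submodule phi C, C `<=` torsion phi q & iso_quotA phi q C]].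

(* The default value phi is never taken when C is a finite submodule, and the *)
(* j-invariant of phi/C does not depend on the choice.                        *)
Definition drinfeld_quotient phi C : drinfeld :=
  xget phi [set psi | exists2 u, separable_isogeny phi psi u & twisted_ker u = C].

Definition supersingular_reps p n (phi : 'I_n -> drinfeld) : Prop :=
  [/\ forall i, supersingular p (phi i),
      forall psi, supersingular p psi -> exists i, drinfeld_isomorphic psi (phi i)
    & forall i j, drinfeld_isomorphic (phi i) (phi j) -> i = j].

Definition isogeny_graph_complete q n (phi : 'I_n -> drinfeld) : Prop :=
  forall i j, exists u, cyclic_isogeny q (phi i) (phi j) u.

End Drinfeld.

(* In {poly {poly R}} the outer variable is Y and the coefficients are        *)
(* polynomials in X; in particular S(X) is S%:P and S(Y) is S^:P.             *)

Definition modular_polynomial (F : finFieldType) (q : {poly F})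
    (Phi : {poly {poly {poly F}}}) : Prop :=
  Phi \is monic /\
  forall (L : closedFieldType) (gamma : {rmorphism {poly F} -> L}),
    [set a | gamma a = 0] <> [set a | q %| a] ->
    forall phi : drinfeld gamma,
      map_poly (horner_eval (jinv phi) \o map_poly gamma) Phi
      = \big[*%R/1]_(C \in cyclic_submodules phi q)
          ('X - (jinv (drinfeld_quotient phi C))%:P).

Definition ideal2 (R : comNzRingType) (a b : R) : set R :=
  [set c | exists x y, c = x * a + y * b].

Section Reduction.
Variables (F : finFieldType) (p : {poly F}) (p_prime : monic_irreducible_poly p).

Definition residue_field : finFieldType := {poly %/ p with p_prime}.

Definition reduction (a : {poly F}) : residue_field := in_qpoly p a.

HB.instance Definition _ := GRing.RMorphism.copy reduction (in_qpoly p).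

End Reduction.

Definition supersingular_polynomial (F : finFieldType) (p : {poly F})
    (p_prime : monic_irreducible_poly p) (L : closedFieldType)
    (iota : {rmorphism residue_field p_prime -> L}) (n : nat)
    (phi : 'I_n -> drinfeld (iota \o reduction p_prime))
    (S : {poly residue_field p_prime}) : Prop :=
  map_poly iota S = \prod_(i < n) ('X - (jinv (phi i))%:P).

(* Main.v *)
Require Import Defs.
From HB Require Import structures.
From mathcomp Require Import all_boot all_order all_algebra all_field.
From mathcomp Require Import boolp classical_sets functions cardinality fsbigop.
From mathcomp Require Import zify.

Set Implicit Arguments.
Unset Strict Implicit.
Unset Printing Implicit Defensive.

Import GRing.Theory.
Local Open Scope classical_set_scope.
Local Open Scope ring_scope.

(** Since the j_i are pairwise distinct, dividing by S(Y) and then by S(X)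
    leaves a remainder of degree < n in each variable, so membership in the
    ideal (S(X), S(Y)) amounts to vanishing at all points (j_i, j_k).  By the
    defining property of the modular polynomial, vanishing at (j_i, j_k) means
    that some quotient phi_i/C has j-invariant j_k.  This is equivalent to the
    existence of a cyclic q-isogeny phi_i -> phi_k, because the quotient by C
    exists and is unique up to isomorphism: there is a nonzero twisted
    polynomial u of tau-degree deg q vanishing on C, and counting roots shows
    that every twisted polynomial vanishing on C is right divisible by u.
    Applied to phi_q this gives the separability of u, applied to u phi_T it
    gives the Drinfeld module phi/C. *)

(** * Twisted polynomials: degree, right division and evaluation *)

Lemma expf_cardX (F : finFieldType) (c : F) n : c ^+ (#|F| ^ n) = c.
Proof. by elim: n => //= n IH; rewrite expnSr exprM IH expf_card. Qed.

Section TwistedTheory.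
Variables (F : finFieldType) (L : fieldType) (gamma : {rmorphism {poly F} -> L}).
Local Notation Ltau := (twisted gamma).
Implicit Types (u v w : Ltau) (x y c : L).

Lemma coef_twistedM u v k :
  (u * v)`_k = \sum_(i < k.+1) u`_i * v`_(k - i) ^+ (#|F| ^ i).
Proof. exact: coef_twisted_mul. Qed.

Lemma coef_twistedD u v k : (u + v)`_k = u`_k + v`_k.
Proof. exact: coefD. Qed.

Lemma coef_twistedN u k : (- u)`_k = - u`_k.
Proof. exact: coefN. Qed.

Lemma coef0_twistedM u v : (u * v)`_0 = u`_0 * v`_0.
Proof. by rewrite coef_twistedM big_ord1 expn0 expr1. Qed.

Lemma coef_twistedM_const u c k :
  (u * twisted_const gamma c)`_k = u`_k * c ^+ (#|F| ^ k).
Proof.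
rewrite coef_twistedM big_ord_recr /= subnn coefC eqxx big1 ?add0r // => i _.
by rewrite coefC subn_eq0 leqNgt ltn_ord /= expq0 mulr0.
Qed.

Lemma coef_const_twistedM u c k : (twisted_const gamma c * u)`_k = c * u`_k.
Proof.
rewrite coef_twistedM big_ord_recl /= coefC eqxx subn0 expr1 big1 ?addr0 //.
by move=> i _; rewrite coefC mul0r.
Qed.

(** Only the index [i = a] survives in the convolution: a smaller one exceeds the degree bound of
    [v], a larger one that of [u]. *)
Lemma coef_twistedM_top u v a b : (size u <= a.+1)%N -> (size v <= b.+1)%N ->
  (u * v)`_(a + b) = u`_a * v`_b ^+ (#|F| ^ a).
Proof.
move=> ua vb; have ak : (a < (a + b).+1)%N by rewrite ltnS leq_addr.
rewrite coef_twistedM (bigD1 (Ordinal ak)) //= addKn big1 ?addr0 // => i.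
rewrite -val_eqE /= neq_ltn => /orP[ia|ai]; last first.
  by rewrite [u`_i]nth_default ?mul0r // (leq_trans ua).
rewrite [v`_ _]nth_default ?expq0 ?mulr0 //.
by apply: leq_trans vb _; rewrite ltn_subRL ltn_add2r.
Qed.

(** The coefficient in degree deg u + deg v is the leading coefficient of [u] times a Frobenius
    power of that of [v], hence nonzero in a field. *)
Lemma size_twistedM u v : u != 0 -> v != 0 ->
  size (u * v) = (size u + size v).-1.
Proof.
move=> u0 v0; have {u0 v0}[su sv] : (0 < size u /\ 0 < size v)%N.
  rewrite !size_poly_gt0 -[_ != 0 :> {poly L}]/(u != 0).
  by rewrite -[twisted_coef v != 0]/(v != 0).
have /eqP lu : u`_(size u).-1 != 0 by rewrite -lead_coefE lead_coef_eq0 -size_poly_gt0.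
have /eqP lv : v`_(size v).-1 != 0 by rewrite -lead_coefE lead_coef_eq0 -size_poly_gt0.
apply/eqP; rewrite eqn_leq; apply/andP; split.
  apply/leq_sizeP => k lek; rewrite -(@subnKC (size u).-1 k); last first.
    by apply: leq_trans lek; rewrite -subn1 -subn1 leq_sub2r // leq_addr.
  have le2 : (size v <= k - (size u).-1)%N.
    rewrite leq_subRL -subn1 ?addnBAC ?subn1 //; apply: leq_trans lek.
    by rewrite -!subn1 leq_sub2r // leq_addr.
  rewrite coef_twistedM_top ?prednK ?(leq_trans le2) //.
  by rewrite [v`_ _]nth_default // expq0 mulr0.
have -> : (size u + size v).-1 = ((size u).-1 + (size v).-1).+1.
  by rewrite -[in LHS](prednK su) -[in LHS](prednK sv) addSn addnS.
rewrite ltnNge; apply/negP => /leq_sizeP/(_ _ (leqnn _)).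
rewrite coef_twistedM_top ?prednK // => /eqP.
by rewrite mulf_eq0 expf_eq0 => /orP[/eqP//|/andP[_ /eqP//]].
Qed.

Lemma twistedM_neq0 u v : u != 0 -> v != 0 -> u * v != 0.
Proof.
move=> u0 v0; rewrite -[_ != 0]/(twisted_coef (u * v) != 0) -size_poly_gt0.
rewrite size_twistedM //; move: u0 v0.
rewrite -[u != 0]/(twisted_coef u != 0) -[v != 0]/(twisted_coef v != 0).
by rewrite -!size_poly_gt0; case: size => // a; case: size => // b; rewrite addnS.
Qed.

Lemma twistedM_cancelr u v w : w != 0 -> u * w = v * w -> u = v.
Proof.
move=> w0 /eqP; rewrite -subr_eq0 -mulrBl; apply: contraTeq.
by rewrite -subr_eq0 => uv; apply: twistedM_neq0.
Qed.

(** Euclidean division on the right: the Frobenius twist falls on the leading coefficient of [u],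
    which stays invertible, so leading terms of [f] can be cancelled one after another. *)
Lemma twisted_modr u f : u != 0 ->
  exists a r : Ltau, f = a * u + r /\ (size r < size u)%N.
Proof.
move=> u0; have su : (0 < size u)%N by rewrite size_poly_gt0.
have [n] := ubnP (size f); elim: n f => // n IH f; rewrite ltnS => fn.
have [fu|uf] := ltnP (size f) (size u).
  by exists 0, f; rewrite mul0r add0r.
pose k := (size f - size u)%N.
(* With this [c], the product of c tau^k with [u] has the same leading term as [f]. *)
pose c := f`_(size f).-1 / (u`_(size u).-1) ^+ (#|F| ^ k).
pose m := Twisted gamma (c *: 'X^k).
have coefmu i : (m * u)`_(k + i) = c * u`_i ^+ (#|F| ^ k).
  have ki : (k < (k + i).+1)%N by rewrite ltnS leq_addr.
  rewrite coef_twistedM (bigD1 (Ordinal ki)) //= coefZ coefXn eqxx mulr1 addKn.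
  rewrite big1 ?addr0 // => j; rewrite -val_eqE /= coefZ coefXn => /negPf->.
  by rewrite mulr0 mul0r.
have lu : u`_(size u).-1 != 0 by rewrite -lead_coefE lead_coef_eq0 -size_poly_gt0.
have sf : (size (f - m * u)%R < n)%N.
  apply: leq_trans fn; rewrite -(prednK (leq_trans su uf)) ltnS.
  apply/leq_sizeP => j lej; rewrite coef_twistedD coef_twistedN.
  have e1 : (size f).-1 = (k + (size u).-1)%N by rewrite -!subn1 addnBA // subnK.
  have kj : (k <= j)%N by apply: leq_trans lej; rewrite e1 leq_addr.
  rewrite -(subnKC kj) coefmu subnKC //; have [<-|jne] := eqVneq (size f).-1 j.
    by rewrite /c e1 addKn divfK ?expf_neq0 // subrr.
  have ltj : ((size f).-1 < j)%N by rewrite ltn_neqAle jne.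
  rewrite [f`_j]nth_default 1?[u`_ _]nth_default ?expq0 ?mulr0 ?subrr //.
    by rewrite -(prednK su) -(ltn_add2l k) subnKC // -e1.
  by rewrite -(prednK (leq_trans su uf)).
have [a [r [E sr]]] := IH _ sf; exists (m + a), r; split=> //.
by rewrite mulrDl -addrA -E addrCA subrr addr0.
Qed.

Lemma twisted_eval_widen u x n : (size u <= n)%N ->
  twisted_eval u x = \sum_(i < n) u`_i * x ^+ (#|F| ^ i).
Proof.
move=> un; rewrite /twisted_eval (big_ord_widen n (fun i => u`_i * x ^+ (#|F| ^ i)) un).
rewrite big_mkcond; apply: eq_bigr => i _; case: ltnP => // ui.
by rewrite nth_default // mul0r.
Qed.

Lemma twisted_evalD u v x :
  twisted_eval (u + v) x = twisted_eval u x + twisted_eval v x.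
Proof.
have le : (size (u + v)%R <= maxn (size u) (size v))%N by apply: size_polyD.
rewrite (twisted_eval_widen x le) (twisted_eval_widen x (leq_maxl _ (size v))).
rewrite (twisted_eval_widen x (leq_maxr (size u) _)) -big_split /=.
by apply: eq_bigr => i _; rewrite coef_twistedD mulrDl.
Qed.

Lemma twisted_eval_add u x y :
  twisted_eval u (x + y) = twisted_eval u x + twisted_eval u y.
Proof.
by rewrite -big_split; apply: eq_bigr => i _; rewrite (expqD gamma) mulrDr.
Qed.

Lemma twisted_eval0 u : twisted_eval u 0 = 0.
Proof. by rewrite /twisted_eval big1 // => i _; rewrite expq0 mulr0. Qed.

Lemma twisted_eval_const c x : twisted_eval (twisted_const gamma c) x = c * x.
Proof.
rewrite (@twisted_eval_widen _ _ 1) ?size_polyC ?leq_b1 //.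
by rewrite big_ord1 coefC expr1.
Qed.

(** Scalars from [F] are fixed by every q^i-power map, so evaluation is F_q-linear. *)
Lemma twisted_eval_scale u (c : F) x :
  twisted_eval u (gamma c%:P * x) = gamma c%:P * twisted_eval u x.
Proof.
rewrite /twisted_eval big_distrr; apply: eq_bigr => i _ /=.
rewrite exprMn -rmorphXn -polyC_exp expf_cardX.
by rewrite mulrCA.
Qed.

Lemma twisted_evalM u v x :
  twisted_eval (u * v) x = twisted_eval u (twisted_eval v x).
Proof.
pose n := (size u + size v)%N.
pose g i j := u`_i * v`_j ^+ (#|F| ^ i) * x ^+ (#|F| ^ (i + j)).
rewrite (@twisted_eval_widen _ _ n); last exact: size_poly.
transitivity (\sum_(k < n) \sum_(i < size u | (i <= k)%N) g i (k - i)%N).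
  apply: eq_bigr => k _; rewrite coef_twistedM big_distrl /=.
  rewrite -(big_mkord xpredT (fun i => u`_i * v`_(k - i) ^+ (#|F| ^ i) * x ^+ (#|F| ^ k))).
  rewrite -(big_mkord (fun i => (i <= k)%N) (fun i => g i (k - i)%N)).
  rewrite (big_nat_widen _ _ n) ?ltn_ord // [RHS](big_nat_widen _ _ n) ?leq_addr //.
  rewrite big_mkcond [RHS]big_mkcond; apply: eq_bigr => i _ /=.
  rewrite ltnS /g; have [ik|] := leqP i k => //=; rewrite subnKC //.
  case: ltnP => // ui.
  by rewrite [u`_i]nth_default // !mul0r.
rewrite (exchange_big_dep xpredT) //=. apply: eq_bigr => i _.
(* Truncating [v] at [n - i] loses no coefficient, because i < [size u]. *)
rewrite [twisted_eval v x](@twisted_eval_widen _ _ (n - i)); last first.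
  by rewrite leq_subRL ?leq_add2r ?(ltnW (ltn_ord i)) // ltnW // ltn_addr.
rewrite (expq_sum gamma) big_distrr /=.
rewrite -(big_mkord (fun k => (i <= k)%N) (fun k => g i (k - i)%N)).
rewrite (big_cat_nat (n := i)) //=; last by rewrite ltnW // ltn_addr.
rewrite big_nat_cond big1 ?add0r; last first.
  by move=> k /andP[/= ki]; rewrite leqNgt ki.
rewrite -[X in \sum_(X <= _ < _ | _) _]add0n big_addn big_mkord.
rewrite big_mkcond; apply: eq_bigr => j _; rewrite leq_addl addnK /g.
by rewrite exprMn mulrA -exprM -expnD addnC.
Qed.

End TwistedTheory.

(** * Root counting and separability through additive polynomials *)

Section Roots.
Variables (F : finFieldType) (L : closedFieldType).
Variable gamma : {rmorphism {poly F} -> L}.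
Local Notation Ltau := (twisted gamma).
Implicit Types (u v w : Ltau) (x y c : L).

(** The additive polynomial of [u] in the commutative ring L[X], where bounds on roots and the
    derivative criterion are available. *)
Definition linpoly u : {poly L} := \sum_(i < size u) u`_i *: 'X^(#|F| ^ i).

Lemma horner_linpoly u x : (linpoly u).[x] = twisted_eval u x.
Proof.
by rewrite horner_sum; apply: eq_bigr => i _; rewrite hornerZ hornerXn.
Qed.

Lemma size_linpoly u : (size (linpoly u) <= (#|F| ^ (size u).-1).+1)%N.
Proof.
apply: leq_trans (size_sum _ _ _) _; apply/bigmax_leqP => i _.
apply: leq_trans (size_scale_leq _ _) _; rewrite size_polyXn ltnS.
rewrite leq_exp2l ?finNzRing_gt1 // -ltnS prednK //.
exact: leq_ltn_trans (ltn_ord i).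
Qed.

Lemma coef_linpoly u k : (linpoly u)`_(#|F| ^ k) = u`_k.
Proof.
rewrite coef_sum; transitivity (\sum_(i < size u | val i == k) u`_i).
  rewrite [RHS]big_mkcond; apply: eq_bigr => i _; rewrite coefZ coefXn.
  rewrite (inj_eq (expnI (finNzRing_gt1 F))) eq_sym.
  by case: eqP; rewrite ?mulr1 ?mulr0.
have [ku|uk] := ltnP k (size u); first by rewrite (big_pred1 (Ordinal ku)).
rewrite nth_default // big1 // => i /eqP ik.
by move: (ltn_ord i); rewrite ik ltnNge uk.
Qed.

Lemma linpoly_eq0 u : (linpoly u == 0) = (u == 0).
Proof.
apply/eqP/eqP => [u0|->]; last by rewrite /linpoly big1 // => i _; rewrite coef0 scale0r.
by apply/twistedP => i; rewrite -coef_linpoly u0 !coef0.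
Qed.

(** If [u] were nonzero, [linpoly u] would be a nonzero polynomial of degree at most q^(d-1), too
    small for q^d distinct roots. *)
Lemma twisted_eq0_roots u (s : seq L) d : uniq s -> (#|F| ^ d <= size s)%N ->
  (forall x, x \in s -> twisted_eval u x = 0) -> (size u <= d)%N -> u = 0.
Proof.
move=> s_uniq ds us ud; apply/eqP; rewrite -linpoly_eq0; apply/negPn/negP => u0.
have /(max_poly_roots u0)/(_ s_uniq) : all (root (linpoly u)) s.
  by apply/allP => x /us ux; rewrite rootE horner_linpoly ux.
rewrite ltnNge (leq_trans (size_linpoly u)) //.
rewrite linpoly_eq0 -[u == 0]/(twisted_coef u == 0) -size_poly_gt0 in u0.
apply: leq_trans ds; rewrite ltn_exp2l ?finNzRing_gt1 //.
by rewrite prednK.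
Qed.

(** For i > 0 the exponent q^i is zero in [L], so only the linear term contributes. *)
Lemma deriv_linpoly u : (linpoly u)^`() = (u`_0)%:P.
Proof.
apply/polyP => k; rewrite coef_deriv coefC /linpoly coef_sum; case: k => [|k] /=.
  by rewrite -[1%N]/(#|F| ^ 0)%N -coef_sum -/(linpoly u) coef_linpoly mulr1n.
rewrite -sumrMnl big1 // => i _; rewrite coefZ coefXn; case: eqP => [E|_]; last first.
  by rewrite mulr0 mul0rn.
rewrite -[LHS]mulr_natr E; suff -> : (#|F| ^ i)%:R = 0 :> L by rewrite mulr0.
have i0 : (0 < i)%N by case: (val i) E.
have q0 : (#|F|)%:R = 0 :> L.
  have [r r_pr charF] := finPcharP F.
  rewrite -(rmorph_nat gamma) -polyC_natr (card_pprimeChar charF).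
  rewrite natrX (pcharf0 charF) expr0n; case: eqP => [E0|_]; last by rewrite polyC0 rmorph0.
  by have := finNzRing_gt1 F; rewrite (card_pprimeChar charF) E0.
by rewrite natrX q0 expr0n; case: (val i) i0.
Qed.

(** The derivative of [linpoly u] is a nonzero constant, so its roots are simple; over an
    algebraically closed field their number is its degree, which is q to the tau-degree of [u]. *)
Lemma separable_ker u : u`_0 != 0 ->
  exists s : seq L, [/\ uniq s, size s = (#|F| ^ (size u).-1)%N &
    forall x, (x \in s) = (twisted_eval u x == 0)].
Proof.
move=> u0; have un0 : u != 0 by apply: contraNneq u0 => ->; rewrite coef0.
have pn0 : linpoly u != 0 by rewrite linpoly_eq0.
have [s E] := closed_field_poly_normal (linpoly u).
have lc0 : lead_coef (linpoly u) != 0 by rewrite lead_coef_eq0.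
exists s; split.
- have : separable_poly (linpoly u).
    rewrite separable_poly.unlock deriv_linpoly coprimep_sym -alg_polyC.
    by rewrite coprimepZl ?coprime1p.
  by rewrite E -mul_polyC separable_mul separable_prod_XsubC => /and3P[].
- have : size (linpoly u) = (size s).+1 by rewrite [in LHS]E size_scale // size_prod_XsubC.
  move=> ss; apply/eqP; rewrite -eqSS -ss eqn_leq size_linpoly /=.
  rewrite ltnNge; apply/negP => /leq_sizeP/(_ _ (leqnn _))/eqP.
  by rewrite coef_linpoly -lead_coefE lead_coef_eq0 -[_ == _]/(u == 0) (negPf un0).
by move=> x; rewrite -horner_linpoly -rootE E rootZ // root_prod_XsubC.
Qed.

End Roots.

(** * Construction of Drinfeld modules and of quotients *)

Section Drinfeld.
Variables (F : finFieldType) (L : closedFieldType).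
Variable gamma : {rmorphism {poly F} -> L}.
Local Notation Ltau := (twisted gamma).
Local Notation tau := (twisted_tau gamma).
Local Notation "c %:tau" := (twisted_const gamma c) (at level 2, format "c %:tau").
Implicit Types (phi psi : drinfeld gamma) (a p q : {poly F}) (C : set L) (u : Ltau).

Lemma coef_tau2 k : (tau ^+ 2)`_k = (k == 2)%:R.
Proof.
rewrite expr2; case: k => [|[|[|k]]].
- by rewrite coef0_twistedM coefX mul0r.
- by rewrite coef_twistedM !big_ord_recl big_ord0 /= !coefX /= expq0 mulr0 mul0r !addr0.
- by rewrite (@coef_twistedM_top _ _ _ _ _ 1 1) ?size_polyX // !coefX /= expr1n mulr1.
rewrite -[k.+3]/(1 + k.+2)%N (@coef_twistedM_top _ _ _ _ _ 1 k.+2) ?size_polyX //.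
by rewrite !coefX /= expq0 mulr0.
Qed.

Definition drinfeld_poly (g D : L) : Ltau :=
  (gamma 'X)%:tau + g%:tau * tau + D%:tau * tau ^+ 2.

Lemma coef_drinfeld_poly g D k : (drinfeld_poly g D)`_k =
  if k is 0 then gamma 'X else if k is 1 then g else if k is 2 then D else 0.
Proof.
rewrite !coef_twistedD !coef_const_twistedM coef_tau2 coefC coefX.
by case: k => [|[|[|k]]] /=; rewrite ?mulr0 ?mulr1 ?addr0 ?add0r.
Qed.

Lemma size_drinfeld_poly g D : D != 0 -> size (drinfeld_poly g D) = 3%N.
Proof.
move=> D0; apply/eqP; rewrite eqn_leq; apply/andP; split.
  by apply/leq_sizeP => [[|[|[|k]]]] //; rewrite coef_drinfeld_poly.
rewrite ltnNge; apply/negP => /leq_sizeP/(_ _ (leqnn _))/eqP.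
by rewrite coef_drinfeld_poly (negPf D0).
Qed.

Lemma drinfeldX phi : phi 'X = drinfeld_poly (dg phi) (dDelta phi).
Proof. exact: dmapT. Qed.

(** Taking constant coefficients is multiplicative, so it suffices to compare on constants and on T.
    In particular phi_a is separable when gamma(a) is nonzero. *)
Lemma coef_drinfeld_const phi a : (phi a)`_0 = gamma a.
Proof.
elim/poly_ind: a => [|a c IH]; first by rewrite !rmorph0 coef0.
rewrite (rmorphD phi) (rmorphM phi) rmorphD rmorphM coef_twistedD coef0_twistedM.
by rewrite IH dmapC drinfeldX coef_drinfeld_poly coefC.
Qed.

Lemma twisted_const_is_zmod_morphism : zmod_morphism (twisted_const gamma).
Proof.
by move=> x y; apply/twistedP => k; rewrite coef_twistedD coef_twistedN /= polyCB coefB.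
Qed.

Lemma twisted_const_is_monoid_morphism : monoid_morphism (twisted_const gamma).
Proof.
split=> // x y; apply/twistedP => k.
by rewrite coef_const_twistedM !coefC; case: eqP; rewrite ?mulr0.
Qed.

HB.instance Definition _ := GRing.isZmodMorphism.Build L Ltau
  (twisted_const gamma) twisted_const_is_zmod_morphism.
HB.instance Definition _ := GRing.isMonoidMorphism.Build L Ltau
  (twisted_const gamma) twisted_const_is_monoid_morphism.

Definition twisted_scalar : F -> Ltau := twisted_const gamma \o gamma \o polyC.

HB.instance Definition _ := GRing.RMorphism.copy twisted_scalar
  (twisted_const gamma \o gamma \o polyC).

(** Scalars of [F] are fixed by Frobenius and hence central; this allows T to be sent to an
    arbitrary twisted polynomial. *)
Lemma twisted_scalar_comm u : commr_rmorph twisted_scalar u.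
Proof.
move=> c; apply/twistedP => k.
rewrite coef_const_twistedM coef_twistedM_const mulrC /= -rmorphXn -polyC_exp.
by rewrite expf_cardX.
Qed.

Lemma drinfeld_exists g D : D != 0 ->
  exists psi : drinfeld gamma, psi 'X = drinfeld_poly g D.
Proof.
move=> D0; pose cfu := @twisted_scalar_comm (drinfeld_poly g D).
have hC c : horner_morph cfu c%:P = (gamma c%:P)%:tau by rewrite horner_morphC.
have hX : horner_morph cfu 'X = drinfeld_poly g D by rewrite horner_morphX.
by exists (@Drinfeld F L gamma (horner_morph cfu) g D hC hX D0).
Qed.

Lemma drinfeld_quotient_exists phi u : u`_0 != 0 ->
  (forall v, twisted_ker u `<=` twisted_ker v -> exists w, v = w * u) ->
  (forall x, twisted_ker u x -> twisted_ker u (twisted_eval (phi 'X) x)) ->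
  exists psi, separable_isogeny phi psi u.
Proof.
move=> u0 udiv ustab; have un0 : u != 0 by apply: contraNneq u0 => ->; rewrite coef0.
have [x ux|w E] := udiv (u * phi 'X).
  by rewrite /twisted_ker /= twisted_evalM; apply: ustab.
have sX : size (phi 'X) = 3%N by rewrite drinfeldX size_drinfeld_poly ?dDelta_neq0.
have Xn0 : phi 'X != 0 by rewrite -[_ == _]/(twisted_coef _ == 0) -size_poly_eq0 sX.
have wn0 : w != 0.
  by apply/eqP => w0; move: (twistedM_neq0 un0 Xn0); rewrite E w0 mul0r eqxx.
have sw : size w = 3%N.
  have arith m n : (0 < m)%N -> (m + 3).-1 = (n + m).-1 -> n = 3%N by lia.
  have := congr1 (fun v : Ltau => size v) E; rewrite /= !size_twistedM // sX.
  by apply: arith; rewrite size_poly_gt0.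
have w0 : w`_0 = gamma 'X.
  have := congr1 (fun v : Ltau => v`_0) E.
  rewrite /= !coef0_twistedM coef_drinfeld_const mulrC => /(mulIf u0) ->//.
have w2 : w`_2 != 0 by rewrite -[2%N]/(3.-1) -sw -lead_coefE lead_coef_eq0.
have [psi psiX] := drinfeld_exists w`_1 w2; exists psi; split=> //.
rewrite /drinfeld_morphism psiX E; congr (_ * u); apply/twistedP => k.
rewrite coef_drinfeld_poly; case: k => [|[|[|k]]] //.
by rewrite nth_default // sw.
Qed.

(** * Submodules isomorphic to A/q and their annihilators *)

Lemma iso_quotA_generator phi q C : monic_irreducible_poly q ->
  iso_quotA phi q C ->
  exists g : {poly F} -> L, [/\ {morph g : a b / a + b},
    forall a b, g (a * b) = twisted_eval (phi a) (g b),
    forall a, g (a * q) = 0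
  & forall x, C x <-> exists2 a : {poly F}, (size a < size q)%N & g a = x].
Proof.
(* [{poly %/ q}] is built from [mk_monic q], which has a default value on unsuitable polynomials;
   here it is [q] itself. *)
move=> q_prime [f [f_inj fC fD fM]]; have hq : mk_monic q = q by apply: mk_monicE.
(* Pulling [f] back along A -> A/q; remainders modulo [q] then enumerate [C]. *)
exists (fun a => f (in_qpoly q a)); split.
- by move=> a b; rewrite rmorphD fD.
- by move=> a b; rewrite rmorphM fM.
- move=> a; have -> : in_qpoly q (a * q) = 0.
    by apply: val_inj; rewrite /= hq Pdiv.RingMonic.rmodp_mull // q_prime.2.
  by apply: (@addrI _ (f 0)); rewrite -fD !addr0.
move=> x; rewrite -fC; split=> [[y _ <-]|[a _ <-]]; last by exists (in_qpoly q a).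
exists (val y); first by rewrite -[in X in (_ < X)%N]hq size_mk_monic.
by congr f; apply: val_inj; apply: in_qpoly_small; apply: size_mk_monic.
Qed.

Lemma iso_quotA_submodule phi q C : monic_irreducible_poly q ->
  iso_quotA phi q C -> submodule phi C /\ C `<=` torsion phi q.
Proof.
move=> q_prime Cq; have [f [_ fC fD fM]] := Cq.
have f0 : f 0 = 0 by apply: (@addrI _ (f 0)); rewrite -fD !addr0.
split.
  split; first by rewrite -fC; exists 0.
    by move=> x y; rewrite -fC => -[a _ <-] [b _ <-]; exists (a + b).
  by move=> a x; rewrite -fC => -[b _ <-]; exists (in_qpoly q a * b).
have [g [_ gM gq gC]] := iso_quotA_generator q_prime Cq.
by move=> x /gC[a _ <-]; rewrite /torsion /twisted_ker /= -gM mulrC gq.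
Qed.

Lemma iso_quotA_seq phi q C : monic_irreducible_poly q -> iso_quotA phi q C ->
  exists s : seq L, [/\ uniq s, size s = (#|F| ^ (size q).-1)%N
    & forall x, x \in s <-> C x].
Proof.
move=> q_prime [f [f_inj <- _ _]].
exists [seq f y | y <- enum {: {poly %/ q}}]; split.
- by rewrite (map_inj_uniq f_inj) enum_uniq.
- by rewrite size_map -cardE card_monic_qpoly ?q_prime.2 //; apply: q_prime.1.1.
move=> x; split=> [/mapP[y _ ->]|[y _ <-]]; first by exists y.
by apply: map_f; rewrite mem_enum.
Qed.

(* A nonzero u of degree d = deg q killing d generators of C over F_q exists
   because d linear equations in d + 1 unknowns have a nonzero solution. *)
Lemma iso_quotA_annihilator phi q C : monic_irreducible_poly q ->
  gamma q != 0 -> iso_quotA phi q C ->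
  exists u, [/\ u`_0 != 0, size u = size q, twisted_ker u = C
    & forall v, C `<=` twisted_ker v -> exists w, v = w * u].
Proof.
move=> q_prime gq Cq; have [s [s_uniq ss sC]] := iso_quotA_seq q_prime Cq.
have [g [gD gM _ gC]] := iso_quotA_generator q_prime Cq.
pose d := (size q).-1; have sq : size q = d.+1.
  by rewrite prednK // (ltn_trans _ q_prime.1.1).
(* Since [C] has q^d elements, nothing nonzero of tau-degree below [d] kills it. *)
have small (v : Ltau) : (size v <= d)%N -> C `<=` twisted_ker v -> v = 0.
  move=> vd Cv; apply: (twisted_eq0_roots s_uniq _ _ vd); first by rewrite ss.
  by move=> x /sC/Cv.
(* A row vector killed by [M] is the coefficient vector of a twisted polynomial vanishing at every
   g(T^j), j < d. *)
pose M : 'M[L]_(d.+1, d) := \matrix_(i, j) g 'X^j ^+ (#|F| ^ i).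
have /rowV0Pn[r /sub_kermxP rM rn0] : kermx M != 0.
  by rewrite kermx_eq0 /row_free neq_ltn ltnS rank_leq_col.
pose u := Twisted gamma (rVpoly r).
have su : (size u <= d.+1)%N by apply: size_poly.
have un0 : u != 0.
  apply: contraNneq rn0 => u0; rewrite -(rVpolyK r).
  by rewrite [rVpoly r](congr1 (@twisted_coef _ _ _) u0) linear0.
have ug (j : 'I_d) : twisted_eval u (g 'X^j) = 0.
  rewrite (twisted_eval_widen _ su); have /rowP/(_ j) := rM; rewrite !mxE => rMj.
  rewrite -[RHS]rMj; apply: eq_bigr => i _; by rewrite !mxE coef_rVpoly_ord.
(* The g(T^j) span [C] over F_q, and evaluation of [u] is F_q-linear. *)
have Cu : C `<=` twisted_ker u.
  move=> x /gC[a]; rewrite sq ltnS => ad <-; rewrite /twisted_ker /=.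
  have -> : a = \sum_(i < d) (a`_i)%:P * 'X^i.
    rewrite -[LHS]coefK poly_def (big_ord_widen d (fun i => a`_i *: 'X^i) ad).
    rewrite big_mkcond; apply: eq_bigr => i _; rewrite mul_polyC.
    by case: ltnP => // ai; rewrite nth_default // scale0r.
  have g0 : g 0 = 0 by apply: (@addrI _ (g 0)); rewrite -gD !addr0.
  rewrite (big_morph g gD g0) (big_morph _ (twisted_eval_add u) (twisted_eval0 u)).
  apply: big1 => i _; rewrite gM dmapC twisted_eval_const twisted_eval_scale ug.
  by rewrite mulr0.
have sud : size u = d.+1.
  apply/eqP; rewrite eqn_leq su ltnNge; apply/negP => ud.
  by move: un0; rewrite (small _ ud Cu) eqxx.
have udiv (v : Ltau) : C `<=` twisted_ker v -> exists w, v = w * u.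
  move=> Cv; have [w [r' [E r'u]]] := twisted_modr v un0; exists w.
  rewrite E (small r') ?addr0 // -1?ltnS -?sud // => x Cx.
  have := Cv x Cx; rewrite /twisted_ker /= E twisted_evalD twisted_evalM.
  by rewrite (Cu x Cx) twisted_eval0 add0r.
(* As phi_q kills [C], it is a left multiple w u; constant coefficients give gamma(q) = w_0 u_0. *)
have u0 : u`_0 != 0.
  have [w E] := udiv _ (iso_quotA_submodule q_prime Cq).2.
  by apply: contraNneq gq => u0; rewrite -(coef_drinfeld_const phi) E coef0_twistedM u0 mulr0.
exists u; split=> //; first by rewrite sud sq.
(* The inclusion of [C] in the kernel of [u] is an equality, as both have q^d elements. *)
have [t [t_uniq st tu]] := separable_ker u0.
apply/seteqP; split=> // x ux; apply/sC.
have ts : (size t <= size s)%N by rewrite st ss sud sq.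
have sub : {subset s <= t} by move=> y /sC/Cu uy; rewrite tu; apply/eqP.
by have [_ ->] := uniq_min_size s_uniq sub ts; rewrite tu; apply/eqP.
Qed.

(** * Isomorphisms and the j-invariant *)

Lemma drinfeld_isomorphismP phi psi (c : L) : c != 0 ->
  drinfeld_morphism phi psi c%:tau <->
  dg phi = dg psi * c ^+ #|F|.-1 /\
  dDelta phi = dDelta psi * (c ^+ #|F|.-1) ^+ #|F|.+1.
Proof.
move=> c0; rewrite /drinfeld_morphism !drinfeldX.
have Q0 : #|F| = #|F|.-1.+1 by rewrite prednK // ltnW // finNzRing_gt1.
have eqg x y : (c * x = y * c ^+ #|F|) <-> x = y * c ^+ #|F|.-1.
  rewrite [in c ^+ #|F|]Q0 exprS mulrCA; split=> [/(mulfI c0)//|->//].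
have eqD x y : (c * x = y * c ^+ (#|F| ^ 2)) <-> x = y * (c ^+ #|F|.-1) ^+ #|F|.+1.
  (* The tau^2 coefficient scales by c^(q^2-1); factoring q^2-1 = (q-1)(q+1) exhibits the power of
     c^(q-1) that cancels in g^(q+1)/Delta. *)
  have -> : (#|F| ^ 2 = (#|F|.-1 * #|F|.+1).+1)%N.
    by move: (#|F|) Q0 => [//|m] _; lia.
  rewrite exprS -exprM mulrCA; split=> [/(mulfI c0)//|->//].
rewrite -eqg -eqD; split=> [E|[E1 E2]].
  split; first have := congr1 (fun v : Ltau => v`_1) E.
    by rewrite coef_const_twistedM coef_twistedM_const !coef_drinfeld_poly expn1.
  have := congr1 (fun v : Ltau => v`_2) E.
  by rewrite coef_const_twistedM coef_twistedM_const !coef_drinfeld_poly.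
apply/twistedP => k; rewrite coef_const_twistedM coef_twistedM_const !coef_drinfeld_poly.
case: k => [|[|[|k]]]; rewrite ?expn0 ?expr1 ?expn1 ?mulr0 ?mul0r //.
by rewrite mulrC.
Qed.

Lemma jinv_isomorphic phi psi : drinfeld_isomorphic phi psi -> jinv phi = jinv psi.
Proof.
case=> c c0 /(drinfeld_isomorphismP _ _ c0)[E1 E2].
rewrite /jinv E1 E2 exprMn -mulf_div divff ?mulr1 //.
by rewrite !expf_neq0.
Qed.

Lemma closed_field_root_exists (x : L) n : (0 < n)%N -> exists c, c ^+ n = x.
Proof.
move=> n0; have [c] := @solve_monicpoly L n (fun i => if i is 0 then x else 0) n0.
case: n n0 => // n _; rewrite big_ord_recl mulr1 big1 ?addr0 => [E|i _]; last first.
  by rewrite mul0r.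
by exists c.
Qed.

(** Over an algebraically closed field the scaling equations can be solved. If g is nonzero, a
    (q-1)-th root of the ratio of the g's works, and equality of j settles Delta; if g vanishes it
    vanishes for both, and a (q^2-1)-th root of the ratio of the Delta's works. *)
Lemma isomorphic_jinv phi psi : jinv phi = jinv psi -> drinfeld_isomorphic phi psi.
Proof.
have D1 := dDelta_neq0 phi; have D2 := dDelta_neq0 psi.
have Q1 : (0 < #|F|.-1)%N by rewrite -ltnS prednK // ?finNzRing_gt1 // ltnW // finNzRing_gt1.
move=> /eqP; rewrite /jinv eqr_div // => /eqP E.
have [g1|g1] := eqVneq (dg phi) 0.
  have g2 : dg psi = 0.
    move/eqP: E; rewrite g1 expr0n mul0r eq_sym mulf_eq0 (negPf D1) orbF expf_eq0.
    by move=> /andP[_ /eqP].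
  have Q2 : (0 < #|F|.-1 * #|F|.+1)%N by rewrite muln_gt0 Q1.
  have [c Ec] := closed_field_root_exists (dDelta phi / dDelta psi) Q2.
    have c0 : c != 0.
    apply/eqP => c0; move/eqP: Ec; rewrite c0 expr0n eqn0Ngt Q2 eq_sym.
    by rewrite mulf_eq0 invr_eq0 (negPf D1) (negPf D2).
    exists c => //; apply/drinfeld_isomorphismP => //; split; first by rewrite g1 g2 mul0r.
  by rewrite -exprM Ec mulrC divfK.
have g2 : dg psi != 0.
  apply: contraNneq g1 => g2; move/eqP: E.
  by rewrite g2 expr0n mul0r mulf_eq0 (negPf D2) orbF expf_eq0 => /andP[_].
have [c Ec] := closed_field_root_exists (dg phi / dg psi) Q1.
have c0 : c != 0.
  apply/eqP => c0; move/eqP: Ec; rewrite c0 expr0n eqn0Ngt Q1 eq_sym.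
  by rewrite mulf_eq0 invr_eq0 (negPf g1) (negPf g2).
exists c => //; apply/drinfeld_isomorphismP => //; rewrite Ec; split.
  by rewrite mulrC divfK.
rewrite expr_div_n mulrA -[dDelta psi * _]mulrC E mulrAC divff ?mul1r //.
by rewrite expf_neq0.
Qed.

(** * Uniqueness of quotients and cyclic isogenies *)

Lemma size_separable_ker (u w : Ltau) : u`_0 != 0 -> w`_0 != 0 ->
  twisted_ker u = twisted_ker w -> size u = size w.
Proof.
move=> u0 w0 uw; have [s [s_uniq ss su]] := separable_ker u0.
have [t [t_uniq st tw]] := separable_ker w0.
have st_eq : size s = size t.
  apply/perm_size/uniq_perm => // x; rewrite su tw.
  apply/eqP/eqP => ?; first by rewrite -[_ = _]/(twisted_ker w x) -uw.
  by rewrite -[_ = _]/(twisted_ker u x) uw.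
have {st_eq}/(expnI (finNzRing_gt1 F)) : (#|F| ^ (size u).-1 = #|F| ^ (size w).-1)%N.
  by rewrite -ss -st.
have pos (v : Ltau) : v`_0 != 0 -> (0 < size v)%N.
  by rewrite lt0n; apply: contraNneq => v0; rewrite nth_default ?v0.
by move: (pos _ u0) (pos _ w0); case: size => // m _; case: size => //= n _ ->.
Qed.

(** Divisibility gives u = a w, and equal kernels force equal degrees, so [a] is a constant. *)
Lemma separable_ker_factor (u w : Ltau) : u`_0 != 0 -> w`_0 != 0 ->
  twisted_ker u = twisted_ker w ->
  (forall v, twisted_ker w `<=` twisted_ker v -> exists b, v = b * w) ->
  exists2 c, c != 0 & u = c%:tau * w.
Proof.
move=> u0 w0 uw wdiv; have [|a E] := wdiv u; first by rewrite uw.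
have wn0 : w != 0 by apply: contraNneq w0 => ->; rewrite coef0.
have an0 : a != 0 by apply: contraNneq u0 => a0; rewrite E a0 mul0r coef0.
have sa : (size a <= 1)%N.
  have arith m n : (0 < n)%N -> (m + n).-1 = n -> (m <= 1)%N by lia.
  have := size_separable_ker u0 w0 uw; rewrite E size_twistedM //.
  by apply: arith; rewrite size_poly_gt0.
have Ea : a = (a`_0)%:tau by apply: val_inj; apply: size1_polyC.
exists a`_0; last by rewrite -Ea.
by apply: contraNneq an0 => a0; rewrite Ea a0 rmorph0.
Qed.

(** Both isogenies are constant multiples of the annihilator of [C], so v = (d/c) u. Cancelling [u]
    on the right in the intertwining relations makes d/c an isomorphism. *)
Lemma quotient_unique phi psi psi' u v q C :
  monic_irreducible_poly q -> gamma q != 0 -> iso_quotA phi q C ->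
  twisted_ker u = C -> twisted_ker v = C ->
  separable_isogeny phi psi u -> separable_isogeny phi psi' v ->
  drinfeld_isomorphic psi psi'.
Proof.
move=> q_prime gq Cq uC vC [un0 Mu u0] [_ Mv v0].
have [w [w0 _ wC wdiv]] := iso_quotA_annihilator q_prime gq Cq; rewrite -wC in wdiv.
have [c c0 Eu] := separable_ker_factor u0 w0 (etrans uC (esym wC)) wdiv.
have [d d0 Ev] := separable_ker_factor v0 w0 (etrans vC (esym wC)) wdiv.
exists (d / c); first by rewrite mulf_neq0 ?invr_neq0.
have {}Ev : v = (d / c)%:tau * u by rewrite Eu mulrA -rmorphM divfK.
apply: (twistedM_cancelr un0); rewrite -!mulrA -Ev -Mv Ev.
by rewrite -mulrA Mu.
Qed.

Lemma drinfeld_quotientP phi q C :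
  monic_irreducible_poly q -> gamma q != 0 -> iso_quotA phi q C ->
  exists2 u, separable_isogeny phi (drinfeld_quotient phi C) u & twisted_ker u = C.
Proof.
move=> q_prime gq Cq; have [u [u0 _ uC udiv]] := iso_quotA_annihilator q_prime gq Cq.
have [[_ _ Cstab] _] := iso_quotA_submodule q_prime Cq.
rewrite -uC in udiv Cstab; have [psi psiu] := drinfeld_quotient_exists u0 udiv (Cstab 'X).
(* A quotient exists, so the default value of [xget] is excluded. *)
rewrite /drinfeld_quotient; case: xgetP => [_ _ //|/(_ psi)[]].
by exists u.
Qed.

(** An isogeny yields its kernel, by uniqueness of the quotient. Conversely, equal j-invariants give
    an isomorphism from phi/C to [psi], and composing it with the quotient isogeny keeps the
    kernel. *)
Lemma cyclic_isogenyP phi psi q : monic_irreducible_poly q -> gamma q != 0 ->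
  (exists u, cyclic_isogeny q phi psi u) <->
  (exists2 C, cyclic_submodules phi q C & jinv psi = jinv (drinfeld_quotient phi C)).
Proof.
move=> q_prime gq; split=> [[u [usep uq]]|[C [_ _ Cq] jC]].
  have [stab tors] := iso_quotA_submodule q_prime uq.
  exists (twisted_ker u) => //; have [v vsep vu] := drinfeld_quotientP q_prime gq uq.
  exact/jinv_isomorphic/(quotient_unique q_prime gq uq _ vu usep vsep).
have [u [un0 Mu u0] uC] := drinfeld_quotientP q_prime gq Cq.
have [c c0 Mc] := isomorphic_jinv (esym jC).
have cn0 : c%:tau != 0 by rewrite fmorph_eq0.
have ker_cu : twisted_ker (c%:tau * u) = twisted_ker u.
  apply/seteqP; split=> x; rewrite /twisted_ker /= twisted_evalM twisted_eval_const.
    by move=> /eqP; rewrite mulf_eq0 (negPf c0) => /eqP.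
  by move=> ->; rewrite mulr0.
exists (c%:tau * u); split; last by rewrite ker_cu uC.
split; first exact: twistedM_neq0.
  by rewrite /drinfeld_morphism -mulrA Mu mulrA Mc mulrA.
by rewrite coef_const_twistedM mulf_neq0.
Qed.

(** Since phi_q is separable, its torsion is a finite list of roots and each [C] is cut out by a
    boolean mask. The product over such [C] is thereby a genuine finite product. *)
Lemma finite_cyclic_submodules phi q : gamma q != 0 ->
  finite_set (cyclic_submodules phi q).
Proof.
move=> gq; have := gq; rewrite -(coef_drinfeld_const phi) => /separable_ker[s [_ _ sE]].
have tors : torsion phi q = [set` s].
  by apply/seteqP; split=> x; rewrite /torsion /twisted_ker /= sE => /eqP.
pose subs := [seq mask m s | m : (size s).-tuple bool].
apply: (@sub_finite_set _ _ ((fun t : seq L => [set` t]) @` [set` subs])); last first.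
  exact/finite_image/finite_seq.
move=> C [_ Cs _]; rewrite tors in Cs.
exists (filter (fun x => `[< C x >]) s) => /=.
  apply/mapP; exists (map_tuple (fun x => `[< C x >]) (in_tuple s)).
    by rewrite mem_enum.
  by rewrite /= filter_mask.
apply/seteqP; split=> x /=; rewrite mem_filter; first by case/andP => /asboolP.
by move=> Cx; apply/andP; split; [apply/asboolP | apply: Cs].
Qed.

End Drinfeld.

(** * Membership in (S(X), S(Y)) as vanishing on a grid *)

Lemma ideal2_vanishing (K L : fieldType) (iota : {rmorphism K -> L}) n
    (j : 'I_n -> L) (S : {poly K}) (P : {poly {poly K}}) :
  injective j -> map_poly iota S = \prod_(i < n) ('X - (j i)%:P) ->
  ideal2 S%:P S^:P P <->
  forall i k, (map_poly (horner_eval (j i) \o map_poly iota) P).[j k] = 0.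
Proof.
move=> j_inj Sj; pose ev i : {rmorphism {poly K} -> L} := horner_eval (j i) \o map_poly iota.
have S0 i : (map_poly iota S).[j i] = 0.
  by rewrite Sj (bigD1 i) //= hornerM !hornerE subrr mul0r.
have evX i : map_poly (ev i) S%:P = 0.
  by rewrite map_polyC; apply/eqP; rewrite polyC_eq0; apply/eqP/S0.
have evY i : map_poly (ev i) S^:P = map_poly iota S.
  rewrite -map_poly_comp; apply: eq_map_poly => c.
  by rewrite /= /horner_eval map_polyC hornerC.
have evI i k x y : (map_poly (ev i) (x * S%:P + y * S^:P)).[j k] = 0.
  rewrite rmorphD !rmorphM /= evX evY.
  by rewrite mulr0 add0r hornerM S0 mulr0.
split=> [[x [y ->]] i k|P0]; first exact: evI.
have {}Sj : map_poly iota S = \prod_(x <- codom j) ('X - x%:P).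
  by rewrite Sj /codom /image_mem big_map big_enum.
have sS : size S = n.+1.
  by rewrite -(size_map_poly iota) Sj size_prod_XsubC size_codom card_ord.
have mS : S \is monic by rewrite -(map_monic iota) Sj monic_prod_XsubC.
have mSP : S^:P \is monic by apply: monic_map.
have vanish (p : {poly L}) : (size p <= n)%N -> (forall i, p.[j i] = 0) -> p = 0.
  move=> sp p0; apply/eqP/negPn/negP => /max_poly_roots.
  have rp : all (root p) (codom j) by apply/allP => _ /codomP[i ->]; rewrite rootE p0.
  have ju : uniq (codom j) by apply/injectiveP.
  by move=> /(_ _ rp ju); rewrite size_codom card_ord ltnNge sp.
(* Division in Y by S(Y), which is monic over K[X]; the remainder still vanishes on the grid. *)
pose R := Pdiv.CommonRing.rmodp P S^:P.
have PR := Pdiv.RingMonic.rdivp_eq mSP P; rewrite -/R in PR.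
have sR : (size R <= n)%N.
  rewrite -ltnS -sS -(size_map_polyC S).
  by rewrite Pdiv.CommonRing.ltn_rmodpN0 // monic_neq0.
have R0 i k : (map_poly (ev i) R).[j k] = 0.
  have := P0 i k; rewrite [in X in X -> _]PR rmorphD hornerD.
  have := evI i k 0 (Pdiv.CommonRing.rdivp P S^:P).
  by rewrite mul0r add0r => ->; rewrite add0r.
(* Division in X, coefficient by coefficient. All remainders turn out to be zero, so R = Q S(X). *)
pose Q := map_poly (fun c => c %/ S) R.
have RM k : R`_k = (Q * S%:P)`_k.
  rewrite coefMC coef_map_id0 ?div0p //; apply/eqP; rewrite -subr_eq0; apply/eqP.
  (* The division takes place over [K] but the points lie in [L]; as [iota] is injective, vanishing
     may be tested over [L]. *)
  apply: (map_poly_inj iota); rewrite rmorph0.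
  have modE : R`_k - R`_k %/ S * S = R`_k %% S.
    by rewrite [X in X - _](divp_eq _ S) addrC addKr.
  apply: (vanish _) => [|i].
    by rewrite size_map_poly modE -ltnS -sS ltn_modp monic_neq0.
  rewrite rmorphB rmorphM hornerD hornerN hornerM S0 mulr0 subr0.
  (* At X = j_i, [R] becomes a polynomial in Y of degree below n with the n roots j_k, so each
     coefficient of [R] vanishes at j_i. *)
  have /polyP/(_ k) : map_poly (ev i) R = 0.
    by apply: vanish => [|l]; [apply: leq_trans (size_poly _ _) sR | apply: R0].
  by rewrite coef_map coef0.
exists Q, (Pdiv.CommonRing.rdivp P S^:P).
by rewrite [LHS]PR addrC; congr (_ + _); apply/polyP.
Qed.

Lemma root_fsbig_prod (L : fieldType) (I : choiceType) (A : set I) (f : I -> L) x :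
  finite_set A ->
  (\big[*%R/1]_(i \in A) ('X - (f i)%:P)).[x] = 0 <-> exists2 i, A i & x = f i.
Proof.
move=> finA; rewrite fsbig_finite //=; split=> [/eqP|[i Ai ->]].
  rewrite horner_prod prodf_seq_eq0 => /hasP[i]; rewrite in_fset_set // inE => Ai.
  by rewrite /= hornerXsubC subr_eq0 => /eqP; exists i.
apply/eqP; rewrite horner_prod prodf_seq_eq0; apply/hasP; exists i.
  by rewrite in_fset_set // inE.
by rewrite /= hornerXsubC subrr.
Qed.

Lemma reduction_eq0 (F : finFieldType) (p a : {poly F})
    (p_prime : monic_irreducible_poly p) :
  (reduction p_prime a == 0) = (p %| a).
Proof.
by rewrite -val_eqE /= mk_monicE // Pdiv.Field.dvdpE. Qed.

(** * Completeness of the graph and the ideal condition *)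

Theorem theorem6p5 (F : finFieldType) (p q : {poly F})
    (p_prime : monic_irreducible_poly p) (q_prime : monic_irreducible_poly q)
    (p_neq_q : p <> q)
    (L : closedFieldType) (iota : {rmorphism residue_field p_prime -> L})
    (L_algebraic : forall x : L, algebraicOver iota x)
    (n : nat) (phi : 'I_n -> drinfeld (iota \o reduction p_prime))
    (phi_reps : supersingular_reps p phi)
    (S : {poly residue_field p_prime})
    (S_supersingular : supersingular_polynomial phi S)
    (Phi : {poly {poly {poly F}}}) (Phi_modular : modular_polynomial q Phi) :
  isogeny_graph_complete q phi <->
  ideal2 S%:P S^:P (map_poly (map_poly (reduction p_prime)) Phi).
Proof.
(* Distinct monic irreducibles do not divide one another, so [q] is nonzero modulo [p]. *)
have gq : iota (reduction p_prime q) != 0.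
  rewrite fmorph_eq0 reduction_eq0; apply/negP => pq; apply: p_neq_q.
  apply/eqP; rewrite -eqp_monic ?p_prime.2 ?q_prime.2 //.
  by apply: q_prime.1.2 pq; rewrite gtn_eqF // p_prime.1.1.
have [_ _ phi_inj] := phi_reps.
have j_inj : injective (fun i => jinv (phi i)).
  by move=> i k /isomorphic_jinv; apply: phi_inj.
rewrite (ideal2_vanishing _ j_inj S_supersingular).
have edge i k : (exists u, cyclic_isogeny q (phi i) (phi k) u) <->
    (map_poly (horner_eval (jinv (phi i)) \o map_poly iota)
      (map_poly (map_poly (reduction p_prime)) Phi)).[jinv (phi k)] = 0.
  rewrite cyclic_isogenyP // -root_fsbig_prod; last exact: finite_cyclic_submodules.
  (* The modular polynomial may be specialised here: the characteristic is not (q), since gamma(q)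
     is nonzero. *)
  rewrite -(Phi_modular.2 L _ _ (phi i)); last first.
    move=> kerE; have : [set a | q %| a] q by apply: dvdpp.
    by rewrite -kerE => /eqP; apply/negP.
  rewrite -map_poly_comp.
  have -> // : map_poly
    ((horner_eval (jinv (phi i)) \o map_poly iota) \o map_poly (reduction p_prime)) Phi =
    map_poly (horner_eval (jinv (phi i)) \o map_poly (iota \o reduction p_prime)) Phi.
  apply: eq_map_poly => a /=; congr (horner_eval _ _).
  by rewrite -map_poly_comp.
by split=> H i k; apply/edge/H.
Qed.
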